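(* Let $w$ be a bi-infinite square-free word over the ternary alphabet $\{0,1,2\}$. Then the following properties are equivalent: (a) $w$ contains at most $16$ distinct palindromes (including the empty word). (b) $w$ avoids overpals, i.e., no factor of $w$ is an overpal. (c) $w$ avoids the letter pattern $abcacba$.
   Context: A word is square-free if it has no factor of the form $uu$ with $u$ a nonempty word. A palindrome is a finite word equal to its reversal; a word contains a palindrome if the palindrome is one of its factors. An overpal is a word of the form $axax^Ra$, where $a$ is a single letter, $x$ is a (possibly empty) finite word, and $x^R$ is the reversal of $x$. A letter pattern is a finite word over variables $a,b,c,\dots$ in which each variable stands for one letter and different variables stand for different letters; $w$ avoids the letter pattern $abcacba$ if no factor of $w$ is obtained from $abcacba$ by substituting pairwise distinct letters of $\{0,1,2\}$ for $a,b,c$. *)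

(* Defs.v *)
From mathcomp Require Import all_boot ssralg ssrint.
From mathcomp Require Import classical_sets cardinality.
Set Implicit Arguments.
Unset Strict Implicit.
Unset Printing Implicit Defensive.

Import GRing.Theory.
Local Open Scope ring_scope.

Definition biword (A : Type) := int -> A.

(* The word w_i w_(i+1) ... w_(i+n-1), where the position i may be negative. *)
Definition window (A : Type) (w : biword A) (i : int) (n : nat) : seq A :=
  [seq w (i + k%:Z) | k <- iota 0 n].

Definition is_factor (A : Type) (w : biword A) (u : seq A) : Prop :=
  exists i : int, u = window w i (size u).

Definition square_free (A : Type) (w : biword A) : Prop :=
  forall u : seq A, u <> [::] -> ~ is_factor w (u ++ u).

Definition palindrome (A : Type) (u : seq A) : Prop := u = rev u.

Definition palindromes_of (A : Type) (w : biword A) : set (seq A) :=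
  [set u | palindrome u /\ is_factor w u]%classic.

Definition overpal (A : Type) (u : seq A) : Prop :=
  exists (a : A) (x : seq A), u = [:: a] ++ x ++ [:: a] ++ rev x ++ [:: a].

Definition avoids_overpals (A : Type) (w : biword A) : Prop :=
  forall u : seq A, is_factor w u -> ~ overpal u.

(* Variables of a letter pattern are natural numbers.  Only the values of h on
   the variables occurring in p matter, so h is injective on those only. *)
Definition letter_pattern_instance (A : Type) (p : seq nat) (u : seq A) : Prop :=
  exists h : nat -> A, {in p &, injective h} /\ u = [seq h v | v <- p].

Definition avoids_letter_pattern (A : Type) (w : biword A) (p : seq nat) : Prop :=
  forall u : seq A, is_factor w u -> ~ letter_pattern_instance p u.

(* a = 0, b = 1, c = 2 *)
Definition abcacba : seq nat := [:: 0; 1; 2; 0; 2; 1; 0]%N.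

(* Main.v *)
Require Import Defs.
From mathcomp Require Import all_boot ssralg ssrint.
From mathcomp Require Import classical_sets functions cardinality.

(* In a square-free bi-infinite ternary word the nonempty palindromes have odd
   length, and those of length 7 are exactly the instances of abcacba: the
   other candidate, cbcacbc, cannot be extended to the left.  Hence overpals and
   instances of abcacba both occur iff some palindrome of length at least 6
   does.  If none does, the palindromes are among the 16 square-free ones of
   length at most 5.  Conversely, backtracking shows that a factor abcacba
   cannot be extended to the left by 50 letters without creating a square or a
   17th palindrome. *)

Set Implicit Arguments.
Unset Strict Implicit.
Unset Printing Implicit Defensive.

Import GRing.Theory.

Lemma size_window (A : Type) (w : biword A) i n : size (window w i n) = n.
Proof. by rewrite size_map size_iota. Qed.

Lemma window_cat (A : Type) (w : biword A) i m n :
  window w i (m + n) = window w i m ++ window w (i + m%:Z)%R n.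
Proof.
rewrite /window iotaD map_cat add0n; congr (_ ++ _).
rewrite -[m in iota m]addn0 iotaDl -map_comp; apply: eq_map => k /=.
by rewrite -addrA -PoszD.
Qed.

Lemma is_factor_window (A : Type) (w : biword A) i n :
  is_factor w (window w i n).
Proof. by exists i; rewrite size_window. Qed.

Lemma is_factor_cat (A : Type) (w : biword A) (u v : seq A) :
  is_factor w (u ++ v) -> is_factor w u /\ is_factor w v.
Proof.
case=> i; rewrite size_cat window_cat => e; split.
  by exists i; rewrite -(take_size_cat v (erefl (size u))) e take_size_cat ?size_window.
exists (i + (size u)%:Z)%R.
by rewrite -{1}(drop_size_cat v (erefl (size u))) e drop_size_cat ?size_window.
Qed.

Lemma is_factor_infix (A : eqType) (w : biword A) (u v : seq A) :
  infix v u -> is_factor w u -> is_factor w v.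
Proof. by case/infixP=> p [s ->] /is_factor_cat[_ /is_factor_cat[]]. Qed.

(** Position [i - 1] always exists because [w] is infinite to the left; every left extension below
    rests on this. *)
Lemma is_factor_cons (A : Type) (w : biword A) (u : seq A) :
  is_factor w u -> exists x, is_factor w (x :: u).
Proof.
case=> i ui; exists (w (i - 1)%R).
have -> : w (i - 1)%R :: u = window w (i - 1)%R (1 + size u).
  by rewrite window_cat /= addr0 subrK -ui.
exact: is_factor_window.
Qed.

(** Extending a square-free word by a letter on the left can only create squares that are
    prefixes. *)
Definition prefix_square (A : eqType) (u : seq A) : bool :=
  has (fun l => take l u == take l (drop l u)) (iota 1 (size u)./2).

Definition has_square (A : eqType) (u : seq A) : bool :=
  has (fun i => prefix_square (drop i u)) (iota 0 (size u)).

Lemma prefix_squareN (A : eqType) (w : biword A) (u : seq A) :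
  square_free w -> is_factor w u -> prefix_square u = false.
Proof.
move=> sqf fu; apply/hasP => -[l]; rewrite mem_iota add1n ltnS => /andP[l0 lu].
move=> /eqP e.
have lu' : l <= size u.
  by rewrite (leq_trans lu) // -{2}(odd_double_half (size u)) -addnn addnA leq_addl.
apply: (sqf (take l u)).
  by move=> /(congr1 size)/=; rewrite size_takel // => l00; rewrite l00 in l0.
move: fu; rewrite -{1}(cat_take_drop l u) -(cat_take_drop l (drop l u)) -e catA.
by case/is_factor_cat.
Qed.

Lemma has_squareN (A : eqType) (w : biword A) (u : seq A) :
  square_free w -> is_factor w u -> has_square u = false.
Proof.
move=> sqf fu; apply/hasPn => i _; apply/negbT/(prefix_squareN sqf).
by move: fu; rewrite -{1}(cat_take_drop i u) => /is_factor_cat[].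
Qed.

Fixpoint words (A : Type) (letters : seq A) (n : nat) : seq (seq A) :=
  if n is m.+1 then [seq c :: u | c <- letters, u <- words letters m]
  else [:: [::]].

Lemma mem_words (A : eqType) (letters : seq A) (u : seq A) :
  {subset u <= letters} -> u \in words letters (size u).
Proof.
elim: u => //= c u IHu cu; apply: allpairs_f; first by rewrite cu ?mem_head.
by apply: IHu => x xu; rewrite cu // inE xu orbT.
Qed.

(** Removing the first and last letters preserves palindromes and shortens by 2, so the descent
    stops at length 6 or 7. *)
Lemma palindrome_center (A : eqType) (u : seq A) : palindrome u -> 5 < size u ->
  exists v, [/\ infix v u, palindrome v & size v \in [:: 6; 7]].
Proof.
move: {2}(size u).+1 (ltnSn (size u)) => n; elim: n u => // n IHn u.
have [|u8 un pu _] := leqP (size u) 7.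
  move=> u7 _ pu u6; exists u; split=> //; first exact: infix_refl.
  by move: u6 u7; rewrite !inE; case: (size u) => [|[|[|[|[|[|[|[|]]]]]]]].
case: u u8 un pu => // x u'; case/lastP: u' => // u y.
rewrite /= size_rcons !ltnS => u6 un; rewrite /palindrome rev_cons rev_rcons /=.
case=> _ /rcons_inj [pu _].
have [v [vu pv sv]] := IHn u (leq_trans (leqnSn _) un) pu u6.
exists v; split=> //; rewrite -cats1.
exact: infix_trans vu (infix_infix [:: x] u [:: y]).
Qed.

(** A letter added on the left creates new palindromes only as prefixes. Length 0 is included, so
    the empty word counts towards the bound. *)
Definition prefix_palindromes (A : eqType) (u : seq A) : seq (seq A) :=
  [seq v <- [seq take l u | l <- iota 0 (size u).+1] | v == rev v].

(* P collects palindromes already met.  The conditionals replace boolean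
   disjunctions because vm_compute evaluates both arguments of ||, which would
   defeat the pruning. *)
Fixpoint unextendable (A : eqType) (letters : seq A) (k n : nat)
    (P : seq (seq A)) (u : seq A) : bool :=
  if n is m.+1 then
    all (fun c => let v := c :: u in
      if prefix_square v then true else
      let Q := undup (prefix_palindromes v ++ P) in
      if k < size Q then true else unextendable letters k m Q v) letters
  else false.

(** The letter that actually precedes [u] in [w] gives a branch that neither test can prune;
    following it, the search exhausts its depth. *)
Lemma unextendableP (A : eqType) (w : biword A) (letters : seq A) k n P u :
    square_free w -> (forall x, x \in letters) ->
    (forall Q : seq (seq A), uniq Q ->
      {in Q, forall v, palindrome v /\ is_factor w v} -> size Q <= k) ->
    {in P, forall v, palindrome v /\ is_factor w v} ->
  is_factor w u -> unextendable letters k n P u = false.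
Proof.
move=> sqf lettersT bound; elim: n P u => // n IHn P u PP /is_factor_cons[c fcu].
apply/allPn; exists c => //; cbv beta zeta.
rewrite (prefix_squareN sqf) //.
set Q := undup (prefix_palindromes _ ++ _).
have QP : {in Q, forall v, palindrome v /\ is_factor w v}.
  move=> v; rewrite mem_undup mem_cat => /orP[|/PP//].
  rewrite mem_filter => /andP[/eqP pv /mapP[l _ vl]]; split=> //.
  by move: fcu; rewrite -(cat_take_drop l (c :: u)) -vl => /is_factor_cat[].
rewrite ltnNge bound ?undup_uniq //; exact/negbT/IHn.
Qed.

Definition ternary : seq 'I_3 :=
  [:: @Ordinal 3 0 isT; @Ordinal 3 1 isT; @Ordinal 3 2 isT].

Lemma mem_ternary (x : 'I_3) : x \in ternary.
Proof. by case: x => [[|[|[|[]]]]]. Qed.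

Definition abcacba_words : seq (seq 'I_3) :=
  [seq [seq nth ord0 p v | v <- abcacba] | p <- [seq p <- words ternary 3 | uniq p]].

Lemma abcacba_wordsP (u : seq 'I_3) :
  reflect (letter_pattern_instance abcacba u) (u \in abcacba_words).
Proof.
apply: (iffP mapP) => [[p]|[h [h_inj ->]]].
  (* [p] lists the values of the three variables, so the default [ord0] is never reached. *)
  rewrite mem_filter => /andP[p_uniq pw] ->; exists (nth ord0 p); split=> //.
  have sp : size p = 3.
    have : all (fun q => size q == 3) (words ternary 3) by [].
    by move=> /allP/(_ _ pw)/eqP.
  have lt3 (i : nat) : i \in abcacba -> i < 3 by rewrite !inE; case: i => [|[|[|]]].
  by move=> i j /lt3 i3 /lt3 j3 /eqP; rewrite nth_uniq ?sp // => /eqP.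
exists [:: h 0; h 1; h 2] => //.
rewrite mem_filter (mem_words (u := [:: _; _; _])) ?andbT => [|x _]; last exact: mem_ternary.
by rewrite /= !inE !(inj_in_eq h_inj).
Qed.

(** Starting from [[:: u]] omits the shorter palindromes inside [u]; undercounting is sound, as it
    can only delay pruning. *)
Lemma abcacba_words_unextendable :
  all (fun u => unextendable ternary 16 50 [:: u] u) abcacba_words.
Proof. by vm_compute. Qed.

(* One more letter on the left is needed: cbcacbc itself is square-free. *)
Lemma centered_palindrome_abcacba : all (fun u =>
    (u == rev u) && has (fun c => ~~ has_square (c :: u)) ternary ==> (u \in abcacba_words))
  (words ternary 6 ++ words ternary 7).
Proof. by vm_compute. Qed.

Definition short_palindromes : seq (seq 'I_3) :=
  [seq u <- flatten [seq words ternary n | n <- iota 0 6] | (u == rev u) && ~~ has_square u].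

(** These are the empty word, 3 letters, 6 words aba and 6 words abcba. Even length puts a square at
    the centre, and ababa starts with abab. *)
Lemma size_short_palindromes : size short_palindromes = 16.
Proof. by vm_compute. Qed.

Lemma abcacba_overpal (A : Type) (u : seq A) :
  letter_pattern_instance abcacba u -> overpal u.
Proof. by case=> h [_ ->]; exists (h 0), [:: h 1; h 2]. Qed.

Lemma palindrome_overpal (A : Type) (u : seq A) : overpal u -> palindrome u.
Proof.
case=> a [x ->].
by rewrite /palindrome !rev_cat revK /= -!catA.
Qed.

(** An empty [x] gives aaa and a single letter gives ababa, both with a square; otherwise the length
    is at least 7. *)
Lemma size_overpal (A : eqType) (w : biword A) (u : seq A) :
  square_free w -> is_factor w u -> overpal u -> 5 < size u.
Proof.
move=> sqf fu [a [x ux]]; move: fu; rewrite {u}ux.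
case: x => [|b [|c x]] fu; last by rewrite !size_cat size_rev /= !(addnS, addSn).
  by case: (sqf [:: a]) => //; case: (@is_factor_cat _ _ [:: a; a] [:: a] fu).
by case: (sqf [:: a; b]) => //; case: (@is_factor_cat _ _ [:: a; b; a; b] [:: a] fu).
Qed.

Lemma long_palindrome_abcacba (w : biword 'I_3) (u : seq 'I_3) :
    square_free w -> is_factor w u -> palindrome u -> 5 < size u ->
  exists v, is_factor w v /\ letter_pattern_instance abcacba v.
Proof.
move=> sqf fu pu /(palindrome_center pu)[v [vu pv sv]].
have fv := is_factor_infix vu fu; exists v; split=> //.
(* This letter rules out cbcacbc: prefixing a, b or c yields the square acbcacbc, bcbc or cc. *)
have [c fcv] := is_factor_cons fv.
have vw : v \in words ternary 6 ++ words ternary 7.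
  have := @mem_words _ ternary v (fun x _ => mem_ternary x).
  rewrite mem_cat; move: sv; rewrite mem_seq2.
  by case/orP=> /eqP-> ->; rewrite ?orbT.
apply/abcacba_wordsP.
have /implyP := allP centered_palindrome_abcacba _ vw; apply.
apply/andP; split; first exact/eqP.
by apply/hasP; exists c; rewrite ?mem_ternary ?(has_squareN sqf).
Qed.

Lemma card_le_size (A : eqType) (X : set A) (k : nat) (P : seq A) :
  (X #<= `I_k)%card -> uniq P -> {in P, forall x, X x} -> size P <= k.
Proof.
move=> /pcard_leP[f] uP PX.
have fP : {in P &, injective f}.
  by move=> x y /PX Xx /PX Xy; apply: (@inj _ _ _ f); rewrite inE.
rewrite -(size_map f) -[leqRHS](size_iota 0); apply: uniq_leq_size.
  by rewrite map_inj_in_uniq.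
move=> _ /mapP[x /PX Xx ->]; rewrite mem_iota /=.
exact: (@funS _ _ _ _ f).
Qed.

Lemma subset_seq_card_le (A : eqType) (X : set A) (P : seq A) :
  (forall x, X x -> x \in P) -> (X #<= `I_(size P))%card.
Proof.
move=> XP; apply/pcard_leP.
(* The position in [P] serves as the injection into [I_(size P)]. *)
have index_inj : {in X &, injective (index^~ P)}.
  move=> x y; rewrite !inE => /XP xP /XP yP e.
  by rewrite -(nth_index x xP) e nth_index.
have [f fE] := Pinj index_inj.
have fX : {homo f : x / X x >-> `I_(size P) x}.
  by move=> x /XP xP; rewrite -fE /= index_mem.
by have [g _] := injPfun fX; squash g.
Qed.

Theorem lemma15 (w : biword 'I_3) (w_square_free : square_free w) :
  ((palindromes_of w #<= `I_16)%card <-> avoids_overpals w) /\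
  (avoids_overpals w <-> avoids_letter_pattern w abcacba).
Proof.
have overpals_abcacba : avoids_overpals w <-> avoids_letter_pattern w abcacba.
  split=> [H u fu /abcacba_overpal|H u fu ou]; first exact: H.
  have [v [fv /(H v fv)//]] := long_palindrome_abcacba w_square_free fu
    (palindrome_overpal ou) (size_overpal w_square_free fu ou).
(* It remains to prove that (a) and (c) are equivalent: the search gives one direction, the list of
   16 the other. *)
split=> //; rewrite overpals_abcacba; split=> [card16 u fu /abcacba_wordsP uw|H].
  have := allP abcacba_words_unextendable _ uw.
  rewrite (@unextendableP _ w) //.
  - exact: mem_ternary.
  - by move=> Q uQ QP; apply: card_le_size card16 uQ _.
  - move=> v; rewrite inE => /eqP->; split=> //.
    by apply/palindrome_overpal/abcacba_overpal/abcacba_wordsP.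
rewrite -size_short_palindromes; apply: subset_seq_card_le => u [pu fu].
rewrite mem_filter -pu eqxx (has_squareN w_square_free) // andTb.
have u6 : size u < 6.
  rewrite ltnNge; apply/negP => /(long_palindrome_abcacba w_square_free fu pu).
  by case=> v [fv /(H v fv)].
apply/flatten_mapP; exists (size u); first by rewrite mem_iota.
by apply: mem_words => x _; apply: mem_ternary.
Qed.
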